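(* Let $n\ge1$, let $1\le d_m\le d_n\le d_M$ be integers, and let $\mathrm A,\mathrm A_n,\mathrm A_d\in\mathbb R^{n\times n}$. Suppose there exist positive definite functions $V_j:\mathbb R^{n\times(d_M+1)}\to\mathbb R$, $j\in\{1,2\}$, such that the following conditions are satisfied for any $\bar x(k)\neq 0$: $$V_1(k+1)<V_1(k)\ \text{ with } x(k+1)=f_1(\bar x(k),k),$$ $$V_2(k+1)<V_2(k)\ \text{ with } x(k+1)=f_2(\bar x(k),k),$$ $$V_1(k+1)<V_2(k)\ \text{ with } x(k+1)=f_1(\bar x(k),k),$$ $$V_2(k+1)<V_1(k)\ \text{ with } x(k+1)=f_2(\bar x(k),k),$$ where $f_1,f_2$ are the subsystems defined in the context, and where each inequality involving $f_j$ is required for every value of the delay $d(k)\in[d_{m_j},d_{M_j}]$. Then the switched system $$x(k+1)=f_{\sigma(k)}(\bar x(k),k),\ k\ge0,\qquad x(k)=\phi(k),\ k\in[-d_M,0],$$ with the switching rule $\sigma$ defined in the context, is asymptotically stable for all time-varying delays $d:\mathbb N\to[d_m,d_M]$, and $\min_{j\in\{1,2\}}\{V_j(\bar x)\}$ is a Lyapunov-Krasovskii functional for this switched system.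
   Context: The state is $x(k)\in\mathbb R^n$, $\phi$ is the initial condition, $d(k)$ is an integer time-varying delay with $d_m\le d(k)\le d_M$, and $d_n\in[d_m,d_M]$ is a constant delay. Let $\bar x(k)=[x^\top(k)\ x^\top(k-1)\ \dots\ x^\top(k-d_M)]^\top$. For a function $V$ of $\bar x(k)$ one writes $V(k):=V(\bar x(k))$. $V$ is positive definite if $V(k)>0$ for all $\bar x(k)\ne0$. A positive definite $V$ is a Lyapunov-Krasovskii functional (LKF) for a system if $V(k+1)-V(k)<0$ along the trajectories of the system (for $\bar x(k)\neq0$). Subsystems: for $j\in\{1,2\}$, $$f_j(\bar x(k),k)=\mathrm A x(k)+\mathrm A_{m_j}x(k-d_{m_j})+\mathrm A_{M_j}x(k-d_{M_j})+\mathrm A_d x(k-d(k)),$$ with $\mathrm A_{m_1}=0$, $\mathrm A_{M_1}=\mathrm A_n$, $d_{m_1}=d_m$, $d_{M_1}=d_n$, and $\mathrm A_{m_2}=\mathrm A_n$, $\mathrm A_{M_2}=0$, $d_{m_2}=d_n$, $d_{M_2}=d_M$. Switching rule: $\sigma(k)=1$ if $d_m\le d(k)\le d_n$, and $\sigma(k)=2$ if $d_n<d(k)\le d_M$. The switched system is an equivalent rewriting of $x(k+1)=\mathrm A x(k)+\mathrm A_nx(k-d_n)+\mathrm A_dx(k-d(k))$.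
   Formalization: For asymptotic stability only, V_1 and V_2 are additionally assumed continuous with V_1(0)=V_2(0)=0; without this the claim fails (n=1, all delays 1, x(k+1)=2x(k), V=1/|x(k)| if x(k)≠0, V=1 if only x(k-1)≠0, V(0)=0). *)

(* Defs.v *)
From HB Require Import structures.
From mathcomp Require Import all_boot all_order all_algebra.
From mathcomp Require Import all_classical all_reals all_analysis.

Set Implicit Arguments.
Unset Strict Implicit.
Unset Printing Implicit Defensive.

Import Order.TTheory GRing.Theory Num.Theory.
Import numFieldNormedType.Exports.

Local Open Scope classical_set_scope.
Local Open Scope ring_scope.

(* The window [x(k) x(k-1) ... x(k-D)] as an n x (D+1) matrix whose column j
   is x(k-j). *)
Definition window (R : realType) (n D : nat) (x : int -> 'cV[R]_n) (k : int) :
    'M[R]_(n, D.+1) :=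
  \matrix_(i < n, j < D.+1) x (k - (j : nat)%:Z) i 0.

(* x(k - h), read off the window at time k; meaningful for h <= D. *)
Definition delayed (R : realType) (n D : nat) (z : 'M[R]_(n, D.+1)) (h : nat) :
    'cV[R]_n := col (inord h) z.

(* x(k+1) = g k (window x k) for k >= 0, and x = phi on [-D, 0].  Values of phi
   outside [-D, 0] and of x before time -D play no role. *)
Definition is_solution (R : realType) (n D : nat)
    (g : nat -> 'M[R]_(n, D.+1) -> 'cV[R]_n) (phi x : int -> 'cV[R]_n) : Prop :=
  (forall s : int, - D%:Z <= s <= 0 -> x s = phi s) /\
  (forall k : nat, x (k%:Z + 1) = g k (window D x k%:Z)).

Definition stable (R : realType) (n D : nat)
    (g : nat -> 'M[R]_(n, D.+1) -> 'cV[R]_n) : Prop :=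
  forall eps : R, 0 < eps -> exists2 delta : R, 0 < delta &
    forall phi x : int -> 'cV[R]_n, is_solution g phi x ->
      (forall s : int, - D%:Z <= s <= 0 -> `|phi s| < delta) ->
      forall k : nat, `|x k%:Z| < eps.

(* Attractivity is global: every solution tends to 0. *)
Definition attractive (R : realType) (n D : nat)
    (g : nat -> 'M[R]_(n, D.+1) -> 'cV[R]_n) : Prop :=
  forall phi x : int -> 'cV[R]_n, is_solution g phi x ->
    (fun k : nat => x k%:Z) @ \oo --> (0 : 'cV[R]_n).

Definition asymptotically_stable (R : realType) (n D : nat)
    (g : nat -> 'M[R]_(n, D.+1) -> 'cV[R]_n) : Prop :=
  stable g /\ attractive g.

(* Nothing is required of V 0, nor any continuity of V. *)
Definition positive_definite (R : realType) (n D : nat)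
    (V : 'M[R]_(n, D.+1) -> R) : Prop :=
  forall z, z != 0 -> 0 < V z.

Definition is_LKF (R : realType) (n D : nat)
    (g : nat -> 'M[R]_(n, D.+1) -> 'cV[R]_n) (V : 'M[R]_(n, D.+1) -> R) : Prop :=
  positive_definite V /\
  (forall phi x : int -> 'cV[R]_n, is_solution g phi x ->
     forall k : nat, window D x k%:Z != 0 ->
       V (window D x (k%:Z + 1)) - V (window D x k%:Z) < 0).

(* Indices j = 1, 2 of the subsystems. *)
Inductive mode : Type := mode1 | mode2.

Definition delay_lo (dm dn : nat) (j : mode) : nat :=
  match j with mode1 => dm | mode2 => dn end.

Definition delay_hi (dn dM : nat) (j : mode) : nat :=
  match j with mode1 => dn | mode2 => dM end.

Definition Alo (R : realType) (n : nat) (An : 'M[R]_n) (j : mode) : 'M[R]_n :=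
  match j with mode1 => 0 | mode2 => An end.

Definition Ahi (R : realType) (n : nat) (An : 'M[R]_n) (j : mode) : 'M[R]_n :=
  match j with mode1 => An | mode2 => 0 end.

(* f_j as a function of the window z at time k and of h = d(k), the only way
   in which f_j depends on k. *)
Definition subsystem (R : realType) (n dm dn dM : nat) (A An Ad : 'M[R]_n)
    (j : mode) (z : 'M[R]_(n, dM.+1)) (h : nat) : 'cV[R]_n :=
  A *m delayed z 0 + Alo An j *m delayed z (delay_lo dm dn j)
  + Ahi An j *m delayed z (delay_hi dn dM j) + Ad *m delayed z h.

Definition switching_rule (dn h : nat) : mode :=
  if (h <= dn)%N then mode1 else mode2.

Definition switched_system (R : realType) (n dm dn dM : nat)
    (A An Ad : 'M[R]_n) (d : nat -> nat) (k : nat) (z : 'M[R]_(n, dM.+1)) :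
    'cV[R]_n :=
  subsystem dm dn A An Ad (switching_rule dn (d k)) z (d k).

(* V'(k+1) < V(k) whenever x(k+1) = f_j(window at k, k) and the window at k is
   nonzero, for every delay value between d_{m_j} and d_{M_j}. *)
Definition decreases_along (R : realType) (n dm dn dM : nat)
    (A An Ad : 'M[R]_n) (j : mode) (V' V : 'M[R]_(n, dM.+1) -> R) : Prop :=
  forall (x : int -> 'cV[R]_n) (k h : nat),
    (delay_lo dm dn j <= h <= delay_hi dn dM j)%N ->
    window dM x k%:Z != 0 ->
    x (k%:Z + 1) = subsystem dm dn A An Ad j (window dM x k%:Z) h ->
    V' (window dM x (k%:Z + 1)) < V (window dM x k%:Z).

(* Main.v *)
(* Whichever mode j is active, the hypotheses give V_j(k+1) < V_1(k) and
   V_j(k+1) < V_2(k), so V = min(V_1, V_2) decreases strictly.  The window then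
   follows one of finitely many linear maps at each step, whatever the delay.
   No radial unboundedness of V is needed for global attractivity: stability
   and homogeneity bound every trajectory, and a trajectory that never enters a
   small ball would stay in a compact annulus, on which V drops by at least a
   fixed c > 0 per step. *)

From HB Require Import structures.
Require Import Defs.
From mathcomp Require Import all_boot all_order all_algebra.
From mathcomp Require Import all_classical all_reals all_analysis.
From mathcomp Require Import zify lra.
Import Order.TTheory GRing.Theory Num.Theory.
Import numFieldNormedType.Exports.
Local Open Scope classical_set_scope.
Local Open Scope ring_scope.

(** * Norm, continuity and compactness for matrices *)

Lemma norm_coord_le {R : realType} {m p : nat} (z : 'M[R]_(m, p)) i j :
  `|z i j| <= `|z|.
Proof.
rewrite [leRHS]/Num.Def.normr /= mx_normrE; apply/bigmax_geP; right => /=.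
by exists (i, j).
Qed.

Lemma mx_norm_lt {R : realType} {m p : nat} (z : 'M[R]_(m, p)) (e : R) :
  0 < e -> (forall i j, `|z i j| < e) -> `|z| < e.
Proof.
move=> e0 ze; rewrite [ltLHS]/Num.Def.normr /= mx_normrE; apply/bigmax_ltP.
by split=> // -[i j] _; exact: ze.
Qed.

Lemma mx_norm_le {R : realType} {m p : nat} (z : 'M[R]_(m, p)) (e : R) :
  0 <= e -> (forall i j, `|z i j| <= e) -> `|z| <= e.
Proof.
move=> e0 ze; rewrite [leLHS]/Num.Def.normr /= mx_normrE; apply/bigmax_leP.
by split=> // -[i j] _; exact: ze.
Qed.

Lemma mx_linear_continuous {R : realType} {m p : nat} (W : normedModType R)
  (f : {linear 'M[R]_(m, p) -> W}) : continuous f.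
Proof.
apply: bounded_linear_continuous.
(* Expanding [z] in elementary matrices bounds [f] by this constant, since no entry of [z] exceeds
   its norm. *)
pose C := \sum_(i < m) \sum_(j < p) `|f (delta_mx i j)|.
have fC z : `|f z| <= C * `|z|.
  rewrite {1}(matrix_sum_delta z) linear_sum mulr_suml.
  apply: le_trans (ler_norm_sum _ _ _) _; apply: ler_sum => i _.
  rewrite linear_sum mulr_suml.
  apply: le_trans (ler_norm_sum _ _ _) _; apply: ler_sum => j _.
  by rewrite linearZ normrZ mulrC ler_wpM2l ?norm_coord_le.
have C0 : 0 <= C by do 2 (apply: sumr_ge0 => ? _).
exists C; split; first exact: num_real.
move=> M CM; apply/nbhs_ballP; exists 1 => //= z.
rewrite -ball_normE /= sub0r normrN => z1.
by apply: le_trans (fC z) _; apply: le_trans (ltW CM); rewrite ler_piMr // ltW.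
Qed.

(** Heine-Borel, carried over from row vectors: [K] is the image under the continuous [vec_mx] of
    its own preimage, and [vec_mx] only rearranges entries. *)
Lemma mx_bounded_closed_compact {R : realType} {m p : nat}
  (K : set 'M[R]_(m, p)) (M : R) :
  (forall z, K z -> `|z| <= M) -> closed K -> compact K.
Proof.
move=> KM clK.
have cvec : continuous (vec_mx : 'rV[R]_(m * p) -> 'M[R]_(m, p)).
  exact: mx_linear_continuous.
have -> : K = vec_mx @` (vec_mx @^-1` K).
  apply/seteqP; split=> [z Kz|_ [v Kv <-] //].
  by exists (mxvec z) => //=; rewrite mxvecK.
apply: continuous_compact; first exact: continuous_subspaceT.
apply: bounded_closed_compact; last by apply: preimage_closed => // v _; exact: cvec.
(* [M] may be negative when [K] is empty, whereas a norm bound has to be nonnegative. *)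
exists `|M|; split; first exact: num_real.
move=> N MN v /= Kv; apply: mx_norm_le => [|i j]; first exact/ltW/(le_lt_trans _ MN).
apply: le_trans (ltW MN); apply: le_trans (ler_norm M).
apply: le_trans (KM _ Kv).
rewrite ord1; case/mxvec_indexP: j => a b.
have -> : v 0 (mxvec_index a b) = vec_mx v a b by rewrite mxE.
exact: norm_coord_le.
Qed.

Definition annulus {R : realType} {m p : nat} (r M : R) : set 'M[R]_(m, p) :=
  [set z | r <= `|z| <= M].

Lemma annulus_compact {R : realType} {m p : nat} (r M : R) :
  compact (@annulus R m p r M).
Proof.
apply: (@mx_bounded_closed_compact _ _ _ _ M) => [z /andP[]//|].
have -> : annulus r M = (fun z : 'M[R]_(m, p) => `|z|) @^-1` `[r, M]%classic.
  by apply/seteqP; split=> z /=; rewrite in_itv.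
by apply: preimage_closed; [move=> z _; exact: norm_continuous|exact: interval_closed].
Qed.

Lemma compact_pos_lower_bound {R : realType} {T : topologicalType}
  {f : T -> R} {K : set T} :
  compact K -> continuous f -> (forall z, K z -> 0 < f z) ->
  exists2 c : R, 0 < c & forall z, K z -> c <= f z.
Proof.
move=> cK cf f0; have [->|/set0P K0] := eqVneq K set0; first by exists 1.
have [c] := compact_EVT_min K0 cK (continuous_subspaceT cf).
rewrite inE => Kc fc; exists (f c); first exact: f0.
by move=> z Kz; apply: fc; rewrite inE.
Qed.

(** * Trajectories under arbitrary switching *)

Definition trajectory {T I : Type} (F : I -> T -> T) (z : nat -> T) : Prop :=
  exists s : nat -> I, forall k, z k.+1 = F (s k) (z k).

(** As the index sequence is arbitrary, the dynamics has no clock: what holds from time 0 holds from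
    any time [N]. *)
Lemma trajectory_shift {T I : Type} (F : I -> T -> T) (z : nat -> T) (N : nat) :
  trajectory F z -> trajectory F (fun k => z (N + k)%N).
Proof. by case=> s zs; exists (fun k => s (N + k)%N) => k; rewrite addnS zs. Qed.

Lemma trajectoryZ {R : pzRingType} {T : lmodType R} {I : Type}
  (F : I -> {linear T -> T}) (z : nat -> T) (a : R) :
  trajectory F z -> trajectory F (fun k => a *: z k).
Proof. by case=> s zs; exists s => k; rewrite zs linearZ. Qed.

(** The inequality is only weak because the trajectory may hit 0, where additivity keeps it. *)
Lemma lyapunov_lt {R : realType} {T : zmodType} {I : Type}
  (F : I -> {additive T -> T}) (V : T -> R) (z : nat -> T) :
  (forall i w, w != 0 -> V (F i w) < V w) -> trajectory F z ->
  forall k, V (z k) <= V (z 0%N).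
Proof.
move=> Vdec [s zs]; elim=> // k IH; rewrite zs; apply: le_trans IH.
by have [->|/Vdec/ltW//] := eqVneq (z k) 0; rewrite raddf0.
Qed.

(** * A common Lyapunov function for finitely many linear maps *)

Section Lyapunov.
Context {R : realType} {m p : nat} {I : finType}
  {F : I -> {linear 'M[R]_(m, p) -> 'M[R]_(m, p)}} {V : 'M[R]_(m, p) -> R}.
Hypotheses (V_cont : continuous V) (V0 : V 0 = 0).
Hypothesis V_pos : forall z, z != 0 -> 0 < V z.
Hypothesis V_dec : forall i z, z != 0 -> V (F i z) < V z.

Lemma annulus_neq0 r M (z : 'M[R]_(m, p)) : 0 < r -> annulus r M z -> z != 0.
Proof. by move=> r0 /andP[rz _]; rewrite -normr_gt0; exact: lt_le_trans rz. Qed.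

(** Sublevel sets of [V] may extend far from 0, so [V < c] alone does not confine the trajectory.
    The inner radius is chosen so that one step cannot jump over the annulus on which [V] is at
    least [c]. *)
Lemma lyapunov_stable (e : R) : 0 < e ->
  exists2 delta : R, 0 < delta & forall z, trajectory F z ->
    `|z 0%N| < delta -> forall k, `|z k| < e.
Proof.
move=> e0.
(* Finiteness of [I] gives one radius [r] for all the maps. *)
have /nbhs_ballP[r /= r0 Fr] :
    \forall w \near (0 : 'M[R]_(m, p)), forall i, `|F i w| < e.
  apply: (@filter_forall _ I (fun i w => `|F i w| < e) _ (nbhs_filter _)) => i.
  have := @mx_linear_continuous _ _ _ _ (F i) 0; rewrite /continuous_at linear0.
  by move/cvgr0Pnorm_lt; apply.
have re0 : 0 < Num.min r e by rewrite lt_min r0 e0.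
have [c c0 Vc] := compact_pos_lower_bound (annulus_compact (Num.min r e) e) V_cont
  (fun z Kz => V_pos z (annulus_neq0 _ _ _ re0 Kz)).
have /nbhs_ballP[q /= q0 Vq] : \forall w \near (0 : 'M[R]_(m, p)), V w < c.
  by apply: (cvgr_lt _ (V_cont 0)); rewrite V0.
(* Radius [q] puts [V] below [c] at time 0; the other bound starts the induction on [k]. *)
exists (Num.min q (Num.min r e)); first by rewrite lt_min q0.
move=> z [s zs]; rewrite lt_min => /andP[z0q z0r].
have Vz : forall k, V (z k) < c.
  move=> k; apply: le_lt_trans (lyapunov_lt _ _ _ V_dec (ex_intro _ s zs) k) _.
  by apply: Vq; rewrite -ball_normE /= sub0r normrN.
have zr : forall k, `|z k| < Num.min r e.
  elim=> // k; rewrite lt_min => /andP[zkr zke].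
  rewrite ltNge; apply/negP => rz.
  have : annulus (Num.min r e) e (z k.+1).
    rewrite /annulus /= rz zs ltW//; apply: Fr.
    by rewrite -ball_normE /= sub0r normrN.
  by move/Vc; rewrite leNgt Vz.
by move=> k; have := zr k; rewrite lt_min => /andP[].
Qed.

Lemma lyapunov_bounded (z : nat -> 'M[R]_(m, p)) :
  trajectory F z -> exists M : R, forall k, `|z k| <= M.
Proof.
move=> tz; have [delta d0 st] := lyapunov_stable _ (@ltr01 R).
(* The [+ 1] avoids a division by 0 and puts [a *: z 0] strictly inside the [delta]-ball. *)
pose a := delta / (`|z 0%N| + 1).
have b0 : 0 < `|z 0%N| + 1 by rewrite ltr_wpDl.
have a0 : 0 < a by rewrite divr_gt0.
exists a^-1 => k; rewrite -[leRHS]mulr1 ler_pdivlMl //.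
rewrite -(gtr0_norm a0) -normrZ ltW //.
apply: (st _ (trajectoryZ _ _ a tz)).
by rewrite normrZ gtr0_norm // -mulrA gtr_pMr // ltr_pdivrMl // mulr1 ltrDl.
Qed.

Lemma lyapunov_attractive (z : nat -> 'M[R]_(m, p)) :
  trajectory F z -> z @ \oo --> (0 : 'M[R]_(m, p)).
Proof.
move=> tz; apply/cvgr0Pnorm_lt => e e0.
have [delta d0 st] := lyapunov_stable _ e0.
have [M zM] := lyapunov_bounded _ tz.
(* One visit to the [delta]-ball is enough: stability restarted at time [N] keeps the tail below
   [e]. *)
have [[N zN]|farz] := pselect (exists N, `|z N| < delta).
  exists N => // k /= Nk; rewrite -(subnKC Nk).
  by apply: (st _ (trajectory_shift _ _ N tz)); rewrite addn0.
exfalso; have Kz k : annulus delta M (z k).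
  by rewrite /annulus /= zM andbT leNgt; apply/negP => zk; apply: farz; exists k.
pose K := @annulus R m p delta M.
have [c c0 Vc] : exists2 c : R, 0 < c & forall i w, K w -> c <= V w - V (F i w).
  (* Each [i] has its own minimal drop on [K]. Stating the bound for all small positive [c] lets a
     finite intersection of neighbourhoods replace the minimum over [i]. *)
  have : \forall c \near 0^'+, forall i w, K w -> c <= V w - V (F i w).
    apply: filter_forall => i.
    have [|w Kw|c c0 Vc] :=
      @compact_pos_lower_bound _ _ (fun w => V w - V (F i w)) K (annulus_compact _ _).
    - move=> w; apply: (@continuousB _ R^o _ V (V \o F i)); first exact: (V_cont w).
      by apply: (@continuous_comp _ _ _ (F i) V); [exact: mx_linear_continuous|exact: V_cont].
    - by rewrite subr_gt0 V_dec // (annulus_neq0 _ _ _ d0 Kw).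
    - near=> b => w Kw; apply: le_trans (Vc _ Kw).
      by near: b; exact: nbhs_right_le.
  move=> H; near (0 : R)^'+ => c.
  by exists c; [near: c; exact: nbhs_right_gt|near: c].
have Vz k : V (z k) <= V (z 0%N) - c *+ k.
  case: tz => s zs; elim: k => [|k IH]; first by rewrite mulr0n subr0.
  by have := Vc (s k) _ (Kz k); rewrite -zs mulrS; lra.
have V0ge : 0 <= V (z 0%N) by rewrite ltW // V_pos // (annulus_neq0 _ _ _ d0 (Kz 0%N)).
(* After more than [V (z 0) / c] steps the accumulated drop would make [V] negative. *)
have /archi_boundP : 0 <= V (z 0%N) / c by rewrite divr_ge0 // ltW.
set k := Num.bound _; rewrite ltr_pdivrMr // mulr_natl => zk.
have : 0 < V (z k) by rewrite V_pos // (annulus_neq0 _ _ _ d0 (Kz k)).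
by have := Vz k; lra.
Unshelve. all: by end_near. Qed.
End Lyapunov.

(** * The switched delay system as linear maps on windows *)

Section Step.
Context {R : realType} {n dM : nat}.
Context {dm dn : nat} {A An Ad : 'M[R]_n}.

(* The state x(k+1) enters as column 0 and the older columns move right. *)
Definition push (u : 'cV[R]_n) (z : 'M[R]_(n, dM.+1)) : 'M[R]_(n, dM.+1) :=
  \matrix_(i, j) if j == 0 then u i 0 else z i (inord j.-1).

Lemma push_linear a u v y z :
  push (a *: u + v) (a *: y + z) = a *: push u y + push v z.
Proof. by apply/matrixP => i j; rewrite !mxE; case: ifP; rewrite ?mxE. Qed.

Lemma window_push (x : int -> 'cV[R]_n) (k : nat) :
  window dM x (k%:Z + 1) = push (x (k%:Z + 1)) (window dM x k%:Z).
Proof.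
apply/matrixP => i j; rewrite !mxE; case: eqP => [->|/eqP j0]; first by rewrite subr0.
have j1 : (0 < j)%N by rewrite lt0n.
rewrite inordK; last by rewrite prednK // ltnW.
by congr (x _ i 0); lia.
Qed.

Definition step_fun (h : nat) (z : 'M[R]_(n, dM.+1)) : 'M[R]_(n, dM.+1) :=
  push (subsystem dm dn A An Ad (switching_rule dn h) z h) z.

(** Fixing [h] also fixes the mode, which leaves a sum of matrix products with columns of [z]. *)
Lemma step_linear h : linear (step_fun h).
Proof.
move=> a y z; rewrite /step_fun -push_linear; congr (push _ _).
rewrite /subsystem /delayed !linearP /= !scalerDr.
rewrite (addrACA (a *: (A *m _))) (addrACA (a *: _ + a *: _)).
by rewrite (addrACA (a *: _ + a *: _ + a *: _)).
Qed.

HB.instance Definition _ h := GRing.isLinear.Build R 'M[R]_(n, dM.+1)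
  'M[R]_(n, dM.+1) *:%R (step_fun h) (step_linear h).

Definition step (h : nat) : {linear 'M[R]_(n, dM.+1) -> 'M[R]_(n, dM.+1)} :=
  step_fun h.

Lemma window_step {d : nat -> nat} {phi x : int -> 'cV[R]_n} (k : nat) :
  is_solution (@switched_system R n dm dn dM A An Ad d) phi x ->
  window dM x (k%:Z + 1) = step (d k) (window dM x k%:Z).
Proof. by case=> _ xs; rewrite window_push xs. Qed.

(** Passes from sequences to matrices: any [z] is the window at time 0 of a sequence whose value at
    time 1 can be prescribed. *)
Lemma decreases_along_push {j : mode} {V' V : 'M[R]_(n, dM.+1) -> R} {h : nat}
  {z : 'M[R]_(n, dM.+1)} :
  decreases_along dm dn A An Ad j V' V ->
  (delay_lo dm dn j <= h <= delay_hi dn dM j)%N -> z != 0 ->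
  V' (push (subsystem dm dn A An Ad j z h) z) < V z.
Proof.
move=> dec hj z0.
(* Time [-j] carries column [j] of [z], and time 1 the successor state. *)
pose x (s : int) :=
  if s == 1 then subsystem dm dn A An Ad j z h else col (inord `|s|%N) z.
have xz : window dM x 0%:Z = z.
  apply/matrixP => i l; rewrite !mxE /x sub0r.
  case: eqP => [|_]; first by lia.
  by rewrite abszN /= mxE inord_val.
have := dec x 0%N h hj; rewrite window_push xz; apply=> //.
Qed.

Lemma min_decreases {V1 V2 : 'M[R]_(n, dM.+1) -> R} {h : nat}
  {z : 'M[R]_(n, dM.+1)} :
  decreases_along dm dn A An Ad mode1 V1 V1 ->
  decreases_along dm dn A An Ad mode2 V2 V2 ->
  decreases_along dm dn A An Ad mode1 V1 V2 ->
  decreases_along dm dn A An Ad mode2 V2 V1 ->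
  (dm <= h <= dM)%N -> z != 0 ->
  Num.min (V1 (step h z)) (V2 (step h z)) < Num.min (V1 z) (V2 z).
Proof.
move=> dec1 dec2 dec12 dec21 /andP[dmh hdM] z0.
rewrite /step /= /step_fun /switching_rule gt_min !lt_min.
(* It suffices that one successor value lies below both current ones; the active mode provides
   it. *)
case: leqP => [hdn|dnh].
  have hj : (dm <= h <= dn)%N by rewrite dmh.
  by rewrite (decreases_along_push dec1 hj z0) (decreases_along_push dec12 hj z0).
have hj : (dn <= h <= dM)%N by rewrite ltnW.
by rewrite (decreases_along_push dec2 hj z0) (decreases_along_push dec21 hj z0) orbT.
Qed.

(** The admissible delays form a finite type, as the Lyapunov argument requires; the lower bound is
    built into it because [V] is known to decrease only for such delays. *)
Lemma window_trajectory {d : nat -> nat} {phi x : int -> 'cV[R]_n}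
  (d_bound : forall k, (dm <= d k <= dM)%N) :
  is_solution (@switched_system R n dm dn dM A An Ad d) phi x ->
  trajectory (fun h : {h : 'I_dM.+1 | (dm <= h)%N} => step (val h))
    (fun k => window dM x k%:Z).
Proof.
move=> sol.
have dlt k : (d k < dM.+1)%N by case/andP: (d_bound k).
have dge k : (dm <= Ordinal (dlt k))%N by case/andP: (d_bound k).
exists (fun k => exist (fun h : 'I_dM.+1 => (dm <= h)%N) _ (dge k)) => k.
by rewrite intS addrC (window_step _ sol).
Qed.

End Step.

(** * From windows back to states *)

Lemma state_norm_le {R : realType} {n : nat} (D : nat) (x : int -> 'cV[R]_n) (k : int) :
  `|x k| <= `|window D x k|.
Proof.
apply: mx_norm_le => // i j; rewrite ord1.
have -> : x k i 0 = window D x k i 0 by rewrite mxE subr0.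
exact: norm_coord_le.
Qed.

Lemma window_norm_lt {R : realType} {n D : nat} (x : int -> 'cV[R]_n) (k : int)
  (e : R) : 0 < e -> (forall s, k - D%:Z <= s <= k -> `|x s| < e) ->
  `|window D x k| < e.
Proof.
move=> e0 xe; apply: mx_norm_lt => // i j; rewrite mxE.
apply: le_lt_trans (norm_coord_le _ _ _) (xe _ _).
by have := ltn_ord j; lia.
Qed.

(* Continuity of V1, V2 and V1(0) = V2(0) = 0 are used for asymptotic stability
   only, and neither can be dropped there. *)
Theorem lemma3 (R : realType) (n dm dn dM : nat) (A An Ad : 'M[R]_n)
    (V1 V2 : 'M[R]_(n, dM.+1) -> R)
    (n_ge1 : (1 <= n)%N)
    (dm_ge1 : (1 <= dm)%N) (dm_le_dn : (dm <= dn)%N) (dn_le_dM : (dn <= dM)%N)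
    (V1_pos : positive_definite V1) (V2_pos : positive_definite V2)
    (V1_dec1 : decreases_along dm dn A An Ad mode1 V1 V1)
    (V2_dec2 : decreases_along dm dn A An Ad mode2 V2 V2)
    (V12_dec1 : decreases_along dm dn A An Ad mode1 V1 V2)
    (V21_dec2 : decreases_along dm dn A An Ad mode2 V2 V1) :
  forall d : nat -> nat, (forall k : nat, (dm <= d k <= dM)%N) ->
    ((continuous V1 /\ V1 0 = 0) -> (continuous V2 /\ V2 0 = 0) ->
       asymptotically_stable (@switched_system R n dm dn dM A An Ad d)) /\
    is_LKF (@switched_system R n dm dn dM A An Ad d)
      (fun z => Num.min (V1 z) (V2 z)).
Proof.
move=> d d_bound; pose V z := Num.min (V1 z) (V2 z).
pose F (h : {h : 'I_dM.+1 | (dm <= h)%N}) := @step R n dM dm dn A An Ad (val h).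
have V_pos : positive_definite V.
  by move=> z z0; rewrite lt_min V1_pos // V2_pos.
have V_dec h z : z != 0 -> V (F h z) < V z.
  apply: min_decreases => //; apply/andP; split; first exact: (svalP h).
  by rewrite -ltnS.
split; last first.
  split=> // phi x sol k xk0.
  rewrite subr_lt0 (window_step _ sol).
  by apply: min_decreases.
move=> [V1c V10] [V2c V20].
have V_cont : continuous V by exact: min_fun_continuous.
have V0 : V 0 = 0 by rewrite /V V10 V20 minxx.
split.
  move=> e e0; have [delta d0 st] := lyapunov_stable V_cont V0 V_pos V_dec e e0.
  exists delta => // phi x sol phid k; apply: le_lt_trans (state_norm_le dM _ _) _.
  apply: (st _ (window_trajectory d_bound sol)).
  (* The window at time 0 consists exactly of the values of [phi] on [[-dM, 0]]. *)
  apply: window_norm_lt => // s; rewrite sub0r => sD.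
  by rewrite (proj1 sol) // phid.
move=> phi x sol; apply/cvgr0Pnorm_lt => e e0.
have /cvgr0Pnorm_lt/(_ e e0) :=
  lyapunov_attractive V_cont V0 V_pos V_dec _ (window_trajectory d_bound sol).
apply: filterS => k; exact: le_lt_trans (state_norm_le dM _ _).
Qed.
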